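(* Let $\Theta$ be a generating parameter of a separable random closed set $\mathbf{A}(\Theta)$, with $b_{\mathbf{A}}(x;\Theta)=h^T(x)g(\Theta)$ a.s., $h=(h_1,\dots,h_K)^T$, $g=(g_1,\dots,g_K)^T$, and assume that $E[|g_i(\Theta)|]<\infty$ for every $i=1,\dots,K$. Then: (1) If $g(\theta)$ is convex in every argument, then $E[\mathbf{A}(\Theta)]\subset A(E[\Theta])$. (2) If $g(\theta)$ is an affine function of $\theta$ in every component $g_i(\theta)$ a.s., then $E[\mathbf{A}(\Theta)]=A(E[\Theta])$.
   Context: For a nonempty set $A\subset\mathbb{R}^d$ let $d_A(x)=\inf_{y\in A}|x-y|$ (Euclidean norm). For a set $A\subset\mathbb{R}^d$ with $\partial A\neq\emptyset$, the oriented distance function (ODF) is $b_A(x)=d_A(x)-d_{A^c}(x)$, $x\in\mathbb{R}^d$. A random closed set is a map $\mathbf{A}$ from a probability space $(\Omega,\mathscr{A},\mathbf{P})$ to the closed subsets of $\mathbb{R}^d$ such that $\{\omega:\mathbf{A}(\omega)\cap K\neq\emptyset\}\in\mathscr{A}$ for every compact $K\subset\mathbb{R}^d$. If $\partial\mathbf{A}\neq\emptyset$ a.s. and $b_{\mathbf{A}}(x_0)$ is integrable for some $x_0$, the expected set of $\mathbf{A}$ is $E[\mathbf{A}]=\{x: E[b_{\mathbf{A}}(x)]\le 0\}$. Parametric sets: $A(\theta)$ denotes a closed set whose geometry depends on a parameter $\theta\in\mathbb{R}^p$ (the generating parameter). Let $\Theta$ be a $p$-dimensional ($p\ge 1$)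 random variable on $(\Omega,\mathscr{A},\mathbf{P})$ with $E|\Theta|<\infty$. The random closed set $\mathbf{A}(\Theta)$ with generating parameter $\Theta$ is the random closed set whose geometry is determined by the realized value of $\Theta$; its ODF, written $b_{\mathbf{A}}(x;\Theta)$, is assumed integrable at some point $x_0$, and its boundary is assumed nonempty a.s., so that $E[\mathbf{A}(\Theta)]$ is defined. The set $A(E[\Theta])$ is the closed set generated by the parameter value $E[\Theta]$. The ODF of a set $A=A(\theta)$ is separable if it has the form $b_A(x;\theta)=h^T(x)g(\theta)$, where $h(x)=(h_1(x),\dots,h_K(x))^T$ and $g(\theta)=(g_1(\theta),\dots,g_K(\theta))^T$ for some functions $h_i(x)$, $g_i(\theta)$, $i=1,\dots,K$. A random closed set $\mathbf{A}$ is separable if there exists a random variable $\Theta$ such that $b_{\mathbf{A}}(x;\Theta)$ is separable a.s., that is, $b_{\mathbf{A}}(x;\Theta)=h^T(x)g(\Theta)$ a.s. with $h$ and $g$ of this form.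
   Formalization: Part (1) is false as printed (balls of radius θ²); added: for each i, h_i ≥ 0 everywhere or g_i is affine. The separable form (with nonempty boundary) and, where used, affinity of g_i are required a.s. and also at E[Θ]; convexity means each g_i is jointly convex in θ. *)

(* Defs.v *)
From HB Require Import structures.
From mathcomp Require Import all_boot all_order all_algebra.
From mathcomp Require Import all_classical all_reals all_analysis.

Set Implicit Arguments.
Unset Strict Implicit.
Unset Printing Implicit Defensive.

Import Order.TTheory GRing.Theory Num.Theory.
Import numFieldNormedType.Exports.

Local Open Scope classical_set_scope.
Local Open Scope ring_scope.

(* The topology of ['rV[R]_n] is the usual one, but its library norm [`|_|] is
   the sup norm; distances below must be Euclidean, hence [enorm]. *)
Definition enorm (R : realType) (n : nat) (x : 'rV[R]_n) : R :=
  Num.sqrt (\sum_(j < n) x ord0 j ^+ 2).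

Definition boundary (U : topologicalType) (A : set U) : set U :=
  closure A `\` interior A.

(* Meaningful for nonempty [A] only, since [inf set0] is a junk value. *)
Definition dist (R : realType) (d : nat) (A : set 'rV[R]_d) (x : 'rV[R]_d) : R :=
  inf [set enorm (x - y) | y in A].

(* Meaningful only when [boundary A] is nonempty, i.e. when [A] and its
   complement are both nonempty. *)
Definition odf (R : realType) (d : nat) (A : set 'rV[R]_d) (x : 'rV[R]_d) : R :=
  dist A x - dist (~` A) x.

Definition random_closed_set (R : realType) (d : nat)
    (disp : measure_display) (T : measurableType disp)
    (X : T -> set 'rV[R]_d) : Prop :=
  (forall w, closed (X w)) /\
  (forall C : set 'rV[R]_d, compact C ->
     measurable [set w | X w `&` C !=set0]).

Definition has_expected_set (R : realType) (d : nat)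
    (disp : measure_display) (T : measurableType disp) (P : probability T R)
    (X : T -> set 'rV[R]_d) : Prop :=
  {ae P, forall w, boundary (X w) !=set0} /\
  (exists x0 : 'rV[R]_d, P.-integrable setT (fun w => (odf (X w) x0)%:E)).

Definition expected_set (R : realType) (d : nat)
    (disp : measure_display) (T : measurableType disp) (P : probability T R)
    (X : T -> set 'rV[R]_d) : set 'rV[R]_d :=
  [set x | ('E_P[fun w => odf (X w) x] <= 0)%E].

(* Coordinatewise measurability is Borel measurability of [Theta]. *)
Definition integrable_vector (R : realType) (p : nat)
    (disp : measure_display) (T : measurableType disp) (P : probability T R)
    (Theta : T -> 'rV[R]_p) : Prop :=
  (forall j : 'I_p, measurable_fun setT (fun w => Theta w ord0 j)) /\
  P.-integrable setT (fun w => (enorm (Theta w))%:E).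

Definition mean (R : realType) (p : nat)
    (disp : measure_display) (T : measurableType disp) (P : probability T R)
    (Theta : T -> 'rV[R]_p) : 'rV[R]_p :=
  \row_(j < p) fine 'E_P[fun w => Theta w ord0 j].

(* A property of the parameter is only required at the values that matter: at
   almost every realization of [Theta] and at the parameter [E[Theta]].  The
   latter has to be listed, as it may lie outside the range of [Theta].
   Requiring the property at every parameter would be too much: the ball of
   radius [theta], with ODF [|x| - theta], needs [0 <= theta]. *)
Definition as_and_at_mean (R : realType) (p : nat)
    (disp : measure_display) (T : measurableType disp) (P : probability T R)
    (Theta : T -> 'rV[R]_p) (Q : 'rV[R]_p -> Prop) : Prop :=
  {ae P, forall w, Q (Theta w)} /\ Q (mean P Theta).

(* [A theta] has an ODF and this ODF is [x |-> h(x)^T g(theta)]. *)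
Definition separable_at (R : realType) (d p K : nat)
    (A : 'rV[R]_p -> set 'rV[R]_d)
    (h : 'I_K -> 'rV[R]_d -> R) (g : 'I_K -> 'rV[R]_p -> R)
    (theta : 'rV[R]_p) : Prop :=
  boundary (A theta) !=set0 /\
  (forall x : 'rV[R]_d, odf (A theta) x = \sum_(i < K) h i x * g i theta).

Definition affine_as (R : realType) (p : nat)
    (disp : measure_display) (T : measurableType disp) (P : probability T R)
    (Theta : T -> 'rV[R]_p) (f : 'rV[R]_p -> R) : Prop :=
  exists (a : R) (c : 'rV[R]_p), as_and_at_mean P Theta
    (fun theta => f theta = a + \sum_(j < p) c ord0 j * theta ord0 j).

(* Main.v *)
(* By separability, E[b_A(x;Theta)] = sum_i h_i(x) E[g_i(Theta)] and
   b_{A(E Theta)}(x) = sum_i h_i(x) g_i(E Theta).  Jensen's inequality (an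
   equality for affine g_i) compares the two term by term, and a closed set with
   nonempty boundary is the sublevel set {b <= 0} of its own oriented distance
   function.  Jensen's inequality on R^p comes from a subgradient at E[Theta],
   built one coordinate at a time as in the Hahn-Banach theorem. *)
Require Import Defs.
From HB Require Import structures.
From mathcomp Require Import all_boot all_order all_algebra.
From mathcomp Require Import all_classical all_reals all_analysis.
From mathcomp Require Import ring lra.

Import Order.TTheory GRing.Theory Num.Theory.
Import numFieldNormedType.Exports.

Local Open Scope classical_set_scope.
Local Open Scope ring_scope.

(** * Integrals of almost everywhere equal functions *)

Section integral_ae_eq.
Context {d : measure_display} {T : measurableType d} {R : realType}.
Variable mu : {measure set T -> \bar R}.
Local Open Scope ereal_scope.

Import HBNNSimple.

(* The integral of a nonnegative function is a supremum over the simple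
   functions below it; cutting these off on a null set leaves their integrals
   unchanged, so measurability of [f] and [g] plays no role. *)
Let ge0_le_integral_ae_eq (f g : T -> \bar R) :
  (forall x, 0 <= f x) -> (forall x, 0 <= g x) ->
  {ae mu, forall x, f x = g x} -> \int[mu]_x f x <= \int[mu]_x g x.
Proof.
move=> f0 g0 [N [mN muN0 fgN]].
rewrite (ge0_integralTE mu f0) (ge0_integralTE mu g0).
apply: ge_ereal_sup => _ [k /= kf <-].
pose k' := proj_nnsfun k (measurableC mN).
have k'E : k' = (k : T -> R) \_ (~` N) :> (T -> R) by rewrite -mrestrict.
apply: ereal_sup_ubound; exists k'.
  move=> x; rewrite k'E patchE; case: ifPn => [xN|_]; last exact: g0.
  suff <- : f x = g x by exact: kf.
  by apply: contrapT => /fgN; rewrite inE in xN; exact: xN.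
rewrite -!integralT_nnsfun k'E.
rewrite [RHS](ge0_negligible_integral mN)//; last 2 first.
- by apply/measurable_realfun.measurable_EFinP.
- by move=> x _; rewrite lee_fin.
rewrite setTD [RHS]integral_mkcond; apply: eq_integral => x _.
by rewrite !patchE; case: ifPn.
Qed.

(** Serves to replace the ODF, whose measurability in [w] is not established here, by its separable
    form. *)
Lemma integral_ae_eq (f g : T -> \bar R) :
  {ae mu, forall x, f x = g x} -> \int[mu]_x f x = \int[mu]_x g x.
Proof.
move=> fg; rewrite integralE [RHS]integralE; congr (_ - _);
  apply/eqP; rewrite eq_le; apply/andP; split;
  apply: ge0_le_integral_ae_eq => //;
  by apply: filterS fg => x fgx; rewrite ?funeposE ?funenegE fgx.
Qed.

End integral_ae_eq.

(** * Subgradients of convex functions *)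

(* The Hahn-Banach step: the new slope [a] separates the left and right
   difference quotients of [F] along [e]. *)
Lemma convex_dominated_extension {R : realType} {E : lmodType R}
    (F L : E -> R) (V : set E) (e : E) :
  (forall (t : R) x y, 0 <= t <= 1 ->
     F (t *: x + (1 - t) *: y) <= t * F x + (1 - t) * F y) ->
  scalar L -> V 0 -> (forall t x y, V x -> V y -> V (t *: x + y)) ->
  (forall v, V v -> L v <= F v) ->
  exists a, forall v r, V v -> L v + r * a <= F (v + r *: e).
Proof.
move=> F_conv L_lin V0 V_lin LF.
have L0 : L 0 = 0.
  by have := L_lin (-1) 0 0; rewrite scaler0 addr0 mulN1r addNr.
have LZ t x : L (t *: x) = t * L x.
  by have := L_lin t x 0; rewrite !addr0 L0 addr0.
(* The left difference quotients: the case [r = - t] of the goal says exactly that [a] is an upper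
   bound of [S]. *)
pose S := [set q | exists v t,
  [/\ V v, 0 < t & q = (L v - F (v - t *: e)) / t]].
have S0 : S !=set0 by exists ((L 0 - F (0 - 1 *: e)) / 1); exists 0, 1.
have Sub u s : V u -> 0 < s -> ubound S ((F (u + s *: e) - L u) / s).
  move=> Vu s0 _ [v [t [Vv t0 ->]]].
  rewrite ler_pdivrMr// mulrAC ler_pdivlMr//.
  have st0 : 0 < s + t by rewrite addr_gt0.
  have st_neq0 : s + t != 0 by rewrite gt_eqF.
  have st1 : 1 - t / (s + t) = s / (s + t) by field.
  (* With these weights the multiples of [e] cancel, so the convex combination lies in [V], where
     [L] is below [F]. *)
  have := F_conv (t / (s + t)) (u + s *: e) (v - t *: e).
  rewrite st1 divr_ge0 ?(ltW t0) ?(ltW st0)//=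
    ler_pdivrMr// mul1r lerDr (ltW s0).
  move=> /(_ isT).
  have -> : t / (s + t) *: (u + s *: e) + s / (s + t) *: (v - t *: e) =
      t / (s + t) *: u + s / (s + t) *: v.
    rewrite !scalerDr scalerN !scalerA addrACA -[RHS]addr0; congr (_ + _).
    by apply/eqP; rewrite subr_eq0; apply/eqP; congr (_ *: _); ring.
  have /LF : V (t / (s + t) *: u + s / (s + t) *: v).
    by apply: (V_lin) => //; rewrite -[_ *: v]addr0; exact: V_lin.
  rewrite L_lin LZ => /le_trans /[apply].
  rewrite -(ler_pM2l st0).
  have E1 x y : (s + t) * (t / (s + t) * x + s / (s + t) * y) = t * x + s * y.
    by field.
  by rewrite !E1; lra.
exists (sup S) => v r Vv.
have [r0|r0|->] := ltgtP r 0; last by rewrite mul0r scale0r !addr0 LF.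
  have : (L v - F (v + r *: e)) / - r <= sup S.
    apply: ub_le_sup; first by exists ((F (0 + 1 *: e) - L 0) / 1); exact: Sub.
    by exists v, (- r); rewrite scaleNr opprK oppr_gt0.
  by rewrite ler_pdivrMr ?oppr_gt0//; lra.
have : sup S <= (F (v + r *: e) - L v) / r by apply: ge_sup => //; exact: Sub.
by rewrite ler_pdivlMr//; lra.
Qed.

Lemma convex_subgradient {R : realType} {p : nat} (f : 'rV[R]_p -> R)
    (m : 'rV[R]_p) : convex_function setT f ->
  exists c : 'rV[R]_p, forall x : 'rV[R]_p,
    f m + \sum_(j < p) c ord0 j * (x ord0 j - m ord0 j) <= f x.
Proof.
move=> f_conv.
(* Since [F 0 = 0], the zero form is below [F] on the zero subspace; a linear form below [F]
   everywhere is a subgradient of [f] at [m]. *)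
pose F y := f (m + y) - f m.
pose dot (c y : 'rV[R]_p) := \sum_(j < p) c ord0 j * y ord0 j.
have dot_lin c : scalar (dot c).
  move=> t x y; rewrite /dot mulr_sumr -big_split; apply: eq_bigr => j _ /=.
  by rewrite !mxE; ring.
have F_conv (t : R) x y : 0 <= t <= 1 ->
    F (t *: x + (1 - t) *: y) <= t * F x + (1 - t) * F y.
  move=> /andP[t0 t1].
  have /= := f_conv (Itv01 t0 t1) (m + x) (m + y) (in_setT _) (in_setT _).
  rewrite {1}/conv/= [X in _ <= X -> _]convRE/= /unstable.onem.
  have -> : t *: (m + x) + (1 - t) *: (m + y) = m + (t *: x + (1 - t) *: y).
    by rewrite !scalerDr addrACA -scalerDl [t + _]addrC subrK scale1r.
  by rewrite /F; lra.
(* The span of the first [k] basis vectors: [V 0] is zero and [V p] is the whole space. *)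
pose V k := [set y : 'rV[R]_p | forall j : 'I_p, (k <= j)%N -> y ord0 j = 0].
suff ext k : (k <= p)%N -> exists c, forall y, V k y -> dot c y <= F y.
  have [c cF] := ext p (leqnn p); exists c => x.
  have /cF : V p (x - m : 'rV[R]_p) by move=> j; rewrite leqNgt ltn_ord.
  rewrite /F [m + _]addrC subrK lerBrDl; apply: le_trans.
  rewrite lerD2l le_eqVlt; apply/orP; left; apply/eqP.
  by apply: eq_bigr => j _; rewrite !mxE.
elim: k => [_|k IHk kp].
  exists 0 => y Vy; have -> : y = 0 by apply/rowP => j; rewrite mxE Vy.
  by rewrite /F addr0 subrr /dot big1// => j _; rewrite mxE mul0r.
have [c cF] := IHk (ltnW kp).
pose k' := Ordinal kp.
have [||||a aF] :=
  @convex_dominated_extension _ _ F (dot c) (V k) (delta_mx ord0 k') F_conv.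
- exact: dot_lin.
- by move=> j _; rewrite mxE.
- by move=> t x y Vx Vy j kj; rewrite !mxE Vx// Vy// mulr0 addr0.
- exact: cF.
exists (\row_j (if j == k' then a else c ord0 j)) => y Vy.
pose v := y - y ord0 k' *: delta_mx ord0 k'.
have vE j : v ord0 j = if j == k' then 0 else y ord0 j.
  rewrite !mxE eqxx/=; case: eqVneq => [->|_]; first by rewrite mulr1 subrr.
  by rewrite mulr0 subr0.
have Vv : V k v.
  move=> j kj; rewrite vE; case: eqVneq => // /eqP jk; apply: Vy.
  by rewrite ltn_neqAle kj andbT; apply/eqP => kE; apply: jk; exact: val_inj.
have := aF v (y ord0 k') Vv; rewrite subrK; apply: le_trans.
rewrite /dot (bigD1 k')//= [in leRHS](bigD1 k')//= vE !mxE eqxx mulr0 add0r.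
rewrite [leRHS]addrC [y _ _ * a]mulrC lerD2l.
rewrite le_eqVlt; apply/orP; left; apply/eqP.
by apply: eq_bigr => j /negPf jk; rewrite vE !mxE jk.
Qed.

(** * Expectations of finite linear combinations *)

Section expectation_linear.
Context {d : measure_display} {T : measurableType d} {R : realType}.
Variable P : probability T R.

Lemma Lfun_sum_scale {n : nat} (c : 'I_n -> R) (X : 'I_n -> T -> R) :
  (forall i, X i \in Lfun P 1) ->
  (fun w => \sum_(i < n) c i * X i w) \in Lfun P 1.
Proof.
move=> X1; have -> : (fun w => \sum_(i < n) c i * X i w) =
    \sum_(i < n) (c i \o* X i).
  by apply/funext => w; rewrite fct_sumE; apply: eq_bigr => i _ /=;
    rewrite mulrC.
by apply: rpred_sum => i _; exact: Lfun_scale.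
Qed.

Lemma expectation_sum_scale {n : nat} (c : 'I_n -> R) (X : 'I_n -> T -> R) :
  (forall i, X i \in Lfun P 1) ->
  'E_P[fun w => (\sum_(i < n) c i * X i w)%R]%E =
    (\sum_(i < n) c i * fine ('E_P[X i])%E)%:E.
Proof.
move=> X1; rewrite unlock.
under eq_integral do rewrite -sumEFin.
rewrite integral_sum//; last first.
  move=> i; under eq_fun do rewrite EFinM.
  by apply: integrableZl => //; exact/Lfun1_integrable.
rewrite -sumEFin; apply: eq_bigr => i _.
under eq_integral do rewrite EFinM.
rewrite integralZl//; last exact/Lfun1_integrable.
rewrite EFinM fineK//; apply: integrable_fin_num => //; exact/Lfun1_integrable.
Qed.

End expectation_linear.

(** * The sign of the oriented distance function *)

Section odf_sign.
Context {R : realType} {d : nat}.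
Implicit Types (A : set 'rV[R]_d) (x : 'rV[R]_d).

(** For empty [A] this rests on the default [inf set0 = 0]; [odf_le0] uses it for a complement that
    may be empty. *)
Lemma dist_ge0 A x : 0 <= dist A x.
Proof. have [A0|/nonemptyPn ->] := pselect (A !=set0); last first.
  by rewrite /dist image_set0 inf0.
have [a Aa] := A0; apply: lb_le_inf; first by exists (enorm (x - a)); exists a.
by move=> _ [y _ <-]; exact: sqrtr_ge0. Qed.

Lemma dist_mem A x : A x -> dist A x = 0.
Proof.
move=> Ax; apply/eqP; rewrite eq_le dist_ge0 andbT; apply: ge_inf.
  by exists 0 => _ [y _ <-]; exact: sqrtr_ge0.
exists x => //; rewrite subrr /enorm big1 ?sqrtr0// => j _.
by rewrite mxE expr0n.
Qed.

(** Links Euclidean distance to the sup-norm topology, and bounds the coordinates of [Theta] by its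
    integrable norm. *)
Lemma coord_le_enorm (x : 'rV[R]_d) j : `|x ord0 j| <= enorm x.
Proof.
rewrite -sqrtr_sqr ler_wsqrtr// (bigD1 j)//= lerDl.
by apply: sumr_ge0 => i _; exact: sqr_ge0.
Qed.

Lemma closure_dist A x : A !=set0 -> dist A x <= 0 -> closure A x.
Proof.
move=> [a Aa] dAx B /nbhs_ballP[e /= e0 eB].
have [||_ [y Ay <-] ye] := @inf_lt _ [set enorm (x - y) | y in A] e.
- by exists (enorm (x - a)); exists a.
- exact: le_lt_trans dAx e0.
exists y; split=> //; apply: eB; split=> // i j.
rewrite ord1; apply: le_lt_trans ye.
by have := coord_le_enorm (x - y) j; rewrite !mxE.
Qed.

(** Off [A] the distance to the complement vanishes, so a nonpositive ODF would put [x] at distance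
    zero from [A], hence in its closure. *)
Lemma odf_le0 A x : closed A -> A !=set0 -> (odf A x <= 0) <-> A x.
Proof.
move=> A_closed A0; rewrite /odf; split=> [|Ax]; last first.
  by rewrite dist_mem// sub0r oppr_le0 dist_ge0.
move=> dx; apply: contrapT => nAx; apply: nAx.
rewrite (iffLR (closure_id _) A_closed); apply: closure_dist => //.
have [Ax|nAx] := pselect (A x); first by rewrite dist_mem.
by move: dx; rewrite (@dist_mem (~` A))// subr0.
Qed.

End odf_sign.

(** * Moments of the generating parameter and Jensen's inequality *)

Section generating_parameter.
Context {R : realType} {p : nat} {disp : measure_display}
  {T : measurableType disp}.
Variables (P : probability T R) (Theta : T -> 'rV[R]_p).
Hypothesis Theta_int : integrable_vector P Theta.

Lemma Lfun1_coord j : (fun w => Theta w ord0 j) \in Lfun P 1.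
Proof.
have [meas_Theta norm_Theta] := Theta_int.
apply/Lfun1_integrable; apply: le_integrable norm_Theta => //.
  exact/measurable_realfun.measurable_EFinP.
move=> w _ /=; rewrite lee_fin.
by rewrite (le_trans (coord_le_enorm _ _))// ler_norm.
Qed.

Let affine_split (a : R) (c : 'rV[R]_p) :
  (fun w => a + \sum_(j < p) c ord0 j * Theta w ord0 j) =
  cst a \+ (fun w => \sum_(j < p) c ord0 j * Theta w ord0 j).
Proof. by []. Qed.

Lemma Lfun1_affine (a : R) (c : 'rV[R]_p) :
  (fun w => a + \sum_(j < p) c ord0 j * Theta w ord0 j) \in Lfun P 1.
Proof.
rewrite affine_split rpredD ?Lfun_cst//.
by apply: Lfun_sum_scale => j; exact: Lfun1_coord.
Qed.

Lemma expectation_affine (a : R) (c : 'rV[R]_p) :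
  'E_P[fun w => (a + \sum_(j < p) c ord0 j * Theta w ord0 j)%R]%E =
  (a + \sum_(j < p) c ord0 j * mean P Theta ord0 j)%:E.
Proof.
have Theta1 := Lfun1_coord.
rewrite affine_split expectationD ?Lfun_cst//; last exact: Lfun_sum_scale.
rewrite expectation_cst expectation_sum_scale// EFinD; congr (_ + _%:E)%E.
by apply: eq_bigr => j _; rewrite mxE.
Qed.

(** The affine function supporting [f] at the mean lies below [f], and its expectation is its value
    at the mean, which is that of [f]. *)
Lemma jensen (f : 'rV[R]_p -> R) :
  convex_function setT f -> P.-integrable setT (fun w => (f (Theta w))%:E) ->
  ((f (mean P Theta))%:E <= 'E_P[f \o Theta])%E.
Proof.
move=> /(convex_subgradient f (mean P Theta))[c cf] f_int.
pose a := f (mean P Theta) - \sum_(j < p) c ord0 j * mean P Theta ord0 j.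
have affE x : f (mean P Theta) +
    \sum_(j < p) c ord0 j * (x ord0 j - mean P Theta ord0 j) =
    a + \sum_(j < p) c ord0 j * x ord0 j.
  rewrite /a -addrA; congr (_ + _); rewrite addrC -sumrB.
  by apply: eq_bigr => j _; rewrite mulrBr.
have <- : 'E_P[fun w => (a + \sum_(j < p) c ord0 j * Theta w ord0 j)%R]%E =
    (f (mean P Theta))%:E by rewrite expectation_affine subrK.
rewrite unlock; apply: le_integral => //.
  by apply/Lfun1_integrable; exact: Lfun1_affine.
by move=> w _; rewrite /= lee_fin -affE.
Qed.

Lemma expectation_affine_as (f : 'rV[R]_p -> R) :
  affine_as P Theta f -> 'E_P[f \o Theta]%E = (f (mean P Theta))%:E.
Proof.
(* The affine form at the mean rewrites the right-hand side; the almost sure form is integrated. *)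
move=> [a [c [f_as ->]]]; rewrite -expectation_affine unlock.
by apply: integral_ae_eq; apply: filterS f_as => w /= ->.
Qed.

Lemma expectation_odf_separable {d K : nat} (A : 'rV[R]_p -> set 'rV[R]_d)
    (h : 'I_K -> 'rV[R]_d -> R) (g : 'I_K -> 'rV[R]_p -> R) (x : 'rV[R]_d) :
  as_and_at_mean P Theta (separable_at A h g) ->
  (forall i, P.-integrable setT (fun w => (g i (Theta w))%:E)) ->
  'E_P[fun w => odf (A (Theta w)) x]%E =
  (\sum_(i < K) h i x * fine ('E_P[g i \o Theta])%E)%:E.
Proof.
move=> [A_sep _] g_int; rewrite -expectation_sum_scale; last first.
  by move=> i; apply/Lfun1_integrable; exact: g_int.
rewrite unlock; apply: integral_ae_eq.
by apply: filterS A_sep => w /= [_ ->].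
Qed.

End generating_parameter.

(* The second premise of the first part, a sign condition on h, is not in the
   source: without it the first part fails, e.g. for the balls
   {x : |x| <= theta^2}, where h = (|x|, -1) and g = (1, theta^2). *)
Theorem theorem4p1 (R : realType) (d p K : nat) (p_gt0 : (0 < p)%N)
    (disp : measure_display) (T : measurableType disp) (P : probability T R)
    (A : 'rV[R]_p -> set 'rV[R]_d) (Theta : T -> 'rV[R]_p)
    (h : 'I_K -> 'rV[R]_d -> R) (g : 'I_K -> 'rV[R]_p -> R)
    (A_closed : forall theta, closed (A theta))
    (Theta_int : integrable_vector P Theta)
    (A_rcs : random_closed_set (fun w => A (Theta w)))
    (A_exp : has_expected_set P (fun w => A (Theta w)))
    (A_sep : as_and_at_mean P Theta (separable_at A h g))
    (g_int : forall i : 'I_K, P.-integrable setT (fun w => (g i (Theta w))%:E)) :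
  ((forall i : 'I_K, convex_function setT (g i)) ->
   (forall i : 'I_K, (forall x, 0 <= h i x) \/ affine_as P Theta (g i)) ->
   expected_set P (fun w => A (Theta w)) `<=` A (mean P Theta)) /\
  ((forall i : 'I_K, affine_as P Theta (g i)) ->
   expected_set P (fun w => A (Theta w)) = A (mean P Theta)).
Proof.
have [_ [A_bd odf_mean]] := A_sep.
have A_mem x : odf (A (mean P Theta)) x <= 0 <-> A (mean P Theta) x.
  (* A boundary point lies in the closure, so its neighbourhood [setT] meets the set, which is thus
     nonempty. *)
  apply: odf_le0 => //; have [z [zA _]] := A_bd.
  by have [y [Ay _]] := zA setT filterT; exists y.
have E_mem x : expected_set P (fun w => A (Theta w)) x <->
    \sum_(i < K) h i x * fine 'E_P[g i \o Theta]%E <= 0.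
  rewrite /expected_set /=.
  by rewrite (expectation_odf_separable P Theta A h g)// lee_fin.
split=> [g_conv h_sgn x|g_aff].
  move=> /E_mem Ex; apply/A_mem; apply: le_trans Ex; rewrite odf_mean.
  (* Jensen's inequality survives multiplication by a nonnegative [h i x]; for an affine [g i] the
     two terms are equal. *)
  apply: ler_sum => i _; have [h0|g_aff] := h_sgn i; last first.
    by rewrite (expectation_affine_as P Theta Theta_int).
  rewrite ler_wpM2l// -lee_fin fineK ?(jensen P Theta)//.
  by apply: expectation_fin_num; apply/Lfun1_integrable; exact: g_int.
rewrite eqEsubset; split=> x.
  move=> /E_mem Ex; apply/A_mem; rewrite odf_mean; apply: le_trans Ex.
  by apply: ler_sum => i _; rewrite (expectation_affine_as P Theta Theta_int).
move=> /A_mem Ax; apply/E_mem; apply: le_trans Ax; rewrite odf_mean.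
by apply: ler_sum => i _; rewrite (expectation_affine_as P Theta Theta_int).
Qed.
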